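(* Let $0<q<1$ and let $\mathcal{F}=\{f_0,f_1\}$ be a system with $\mathrm{Dom}(f_0)=[0,q]$, $\mathrm{Dom}(f_1)=[q,1]$, $0\le f_0(0)<f_0(q)\le1$ and $0\le f_1(q)<f_1(1)\le1$. Let $\alpha=(\alpha_i)_{i\ge0}$, $\beta=(\beta_i)_{i\ge0}$ be its critical itineraries. If the topological entropy $\log s$ of $\mathcal{F}$ is positive, then $$s^{-1}=\min\Big\{t\in(0,1):\ \sum_{i=0}^\infty\alpha_it^i=\sum_{i=0}^\infty\beta_it^i\Big\}.$$ Moreover, $\mathcal{F}$ in $[0,1]$ is topologically semiconjugate to a system $U=\{U_0,U_1\}$ in $[0,1]$, where $U_0,U_1$ are affine maps with slope $s$. If in addition to $\log s>0$ we also assume that $f_0(0)=0$ and $f_1(1)=1$, then $U$ is of the form $$U_0(x)=sx\ \text{ for }0\le x\le p,\qquad U_1(x)=s(x-1)+1\ \text{ for }p\le x\le1,$$ where $p=(1-s^{-1})\sum_{i=0}^\infty\alpha_is^{-i}$.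
   Context: A system is a finite family of continuous strictly monotone real-valued functions, each defined on a compact interval with more than one point. Compositions are taken with their natural domain (possibly empty). **Entropy.** For $\mathcal{F}=\{f_0,f_1\}$ let $\ell(m)$ be the number of words $(i_1,\ldots,i_m)\in\{0,1\}^m$ such that $\mathrm{Dom}(f_{i_m}\circ\cdots\circ f_{i_1})$ has nonempty interior; $s=\limsup_{m\to\infty}\ell(m)^{1/m}$ and the topological entropy of $\mathcal{F}$ is $\log s$. **Critical itineraries.** Put $P_1=[0,q]$, $P_2=[q,1]$. The sequences $\alpha,\beta\in\{0,1\}^{\{0,1,2,\ldots\}}$ are determined by: $\alpha_0=0$, $\beta_0=1$; for $i\ge1$, $f_{\alpha_{i-1}}\circ\cdots\circ f_{\alpha_0}(q)\in P_{\alpha_i+1}$, and $\alpha_i=0$ if this point equals $q$; for $i\ge1$, $f_{\beta_{i-1}}\circ\cdots\circ f_{\beta_0}(q)\in P_{\beta_i+1}$, and $\beta_i=1$ if this point equals $q$. **Semiconjugacy.** A set $K\subset\mathbb{R}$ is invariant for a system if it is mapped into itself (where defined) by all the maps of the system and their inverses, hence by all their compositions. For systems $\mathcal{F}$ and $U$ indexed by $\{0,1\}$ and invariant sets $K$, $\widetilde K$ respectively, $\mathcal{F}$ in $K$ is topologically semiconjugate to $U$ in $\widetilde K$ if there are a map $\tau:\{0,1\}\to\{0,1\}$ and an order preserving (i.e. $x\le y\Rightarrow\varphi(x)\le\varphi(y)$) continuous surjection $\varphi:K\to\widetilde K$ such that for each $i$, $\varphi(K\cap\mathrm{Dom}(f_i))\subset\widetilde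 K\cap\mathrm{Dom}(U_{\tau(i)})$ and $\varphi(f_i(x))=U_{\tau(i)}(\varphi(x))$ for all $x\in K\cap\mathrm{Dom}(f_i)$. *)

(* Defs.v *)
From HB Require Import structures.
From mathcomp Require Import all_boot all_order all_algebra.
From mathcomp Require Import all_classical all_reals all_analysis.

Set Implicit Arguments.
Unset Strict Implicit.
Unset Printing Implicit Defensive.

Import Order.TTheory GRing.Theory Num.Theory.
Import numFieldNormedType.Exports.

Local Open Scope classical_set_scope.
Local Open Scope ring_scope.

(* A partial real function; the values of [pval] outside [pdom] are junk and
   must never be relied upon. *)
Record partial_map (R : realType) := PartialMap {
  pdom : set R;
  pval :> R -> R
}.

Definition partial_id (R : realType) : partial_map R := PartialMap setT id.

Definition partial_comp (R : realType) (g f : partial_map R) : partial_map R :=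
  PartialMap [set x | pdom f x /\ pdom g (f x)] (g \o f).

Definition is_system (R : realType) (I : finType) (F : I -> partial_map R) : Prop :=
  forall i : I,
    [/\ exists a b : R, a < b /\ pdom (F i) = `[a, b]%classic,
        {within pdom (F i), continuous (F i)} &
        (forall x y, pdom (F i) x -> pdom (F i) y -> x < y -> F i x < F i y) \/
        (forall x y, pdom (F i) x -> pdom (F i) y -> x < y -> F i y < F i x)].

(* For w = [:: i_1; ...; i_m] this is F i_m \o ... \o F i_1: the first letter
   is applied first. *)
Definition word_comp (R : realType) (I : finType) (F : I -> partial_map R)
    (w : seq I) : partial_map R :=
  foldl (fun g i => partial_comp (F i) g) (partial_id R) w.

(* From here on the index set {0, 1} is [bool], with false for 0 and true for
   1; the coercion nat_of_bool recovers the digits. *)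

Definition word_count (R : realType) (F : bool -> partial_map R) (m : nat) : nat :=
  #|[pred w : m.-tuple bool | `[< interior (pdom (word_comp F w)) !=set0 >]]|.

(* The sequence takes its values in [0, 2], so the real limsup is
   the true one. *)
Definition growth_rate (R : realType) (F : bool -> partial_map R) : R :=
  limn_sup (fun m : nat => (word_count F m)%:R `^ (m%:R)^-1).

Definition topological_entropy (R : realType) (F : bool -> partial_map R) : \bar R :=
  lne (growth_rate F)%:E.

(* [piece q false] is P_1 and [piece q true] is P_2. *)
Definition piece (R : realType) (q : R) (b : bool) : set R :=
  if b then `[q, 1]%classic else `[0, q]%classic.

(* c is both the initial digit and the digit chosen when the orbit returns to
   q: alpha is the critical itinerary for c = 0, beta the one for c = 1. *)
Definition critical_itinerary (R : realType) (F : bool -> partial_map R) (q : R)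
    (c : bool) (a : nat -> bool) : Prop :=
  a 0%N = c /\
  forall i : nat, (1 <= i)%N ->
    let x := word_comp F (mkseq a i) q in
    piece q (a i) x /\ (x = q -> a i = c).

Definition digit_series (R : realType) (a : nat -> bool) (t : R) : R :=
  limn (pseries (fun i : nat => (a i)%:R) t).

(* The second clause is invariance under the inverse maps: F i is injective on
   its domain and its inverse sends F i x to x. *)
Definition invariant_set (R : realType) (I : finType) (F : I -> partial_map R)
    (K : set R) : Prop :=
  (forall (i : I) (x : R), pdom (F i) x -> K x -> K (F i x)) /\
  (forall (i : I) (x : R), pdom (F i) x -> K (F i x) -> K x).

Definition semiconjugate (R : realType) (F : bool -> partial_map R) (K : set R)
    (U : bool -> partial_map R) (K' : set R) : Prop :=
  [/\ invariant_set F K, invariant_set U K' &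
      exists (tau : bool -> bool) (phi : R -> R),
        [/\ forall x y, K x -> K y -> x <= y -> phi x <= phi y,
            {within K, continuous phi},
            phi @` K = K' &
            forall i : bool,
              phi @` (K `&` pdom (F i)) `<=` K' `&` pdom (U (tau i)) /\
              forall x, (K `&` pdom (F i)) x ->
                phi (F i x) = U (tau i) (phi x)]].

Definition affine_with_slope (R : realType) (s : R) (f : partial_map R) : Prop :=
  exists c : R, forall x, pdom f x -> f x = s * x + c.

Definition is_minimum (R : realType) (A : set R) (m : R) : Prop :=
  A m /\ forall t, A t -> m <= t.

(* Main.v *)
(* For 0 < t < 1 let H_t(x) be the generating function, at t, of the itinerary of
   x. It satisfies H_t(x) = i + t H_t(f_i x), with an exceptional jump at q which
   vanishes exactly when the two critical series agree at t. Iterating the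
   equation along all words of length m gives
     H_t(y) - H_t(x) = jump * sum_(j < m) t^j K_j(x, y) + t^m * (remainder),
   where K_j counts the words of length j whose branch sends [x, y] across q and
   the remainder is bounded by the number of laps. If t < 1/s the remainder dies
   out, so H_t is monotone in the direction given by the sign of the jump, and
   H_t(0) = t H_t(f_0 0) forces that sign to be positive. Letting t tend to 1/s,
   H_(1/s) is nondecreasing; its jump vanishes, for otherwise the sums of
   K_j s^-j would be bounded, whereas submultiplicativity gives at least s^m laps.
   The rescaling of H_(1/s) to [0, 1] is then the semiconjugacy. *)
Require Import Defs.
From HB Require Import structures.
From mathcomp Require Import all_boot all_order all_algebra.
From mathcomp Require Import all_classical all_reals all_analysis.
From mathcomp Require Import ring lra.

Set Implicit Arguments.
Unset Strict Implicit.
Unset Printing Implicit Defensive.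

Import Order.TTheory GRing.Theory Num.Theory.
Import numFieldNormedType.Exports.

Local Open Scope classical_set_scope.
Local Open Scope ring_scope.

(** * Contraction estimates and power series with digits 0 and 1 *)

Section Analysis.
Variable R : realType.
Implicit Types (t r C : R) (a : nat -> bool).

Lemma le_addr_geometric (x y C t : R) : 0 <= t < 1 ->
  (forall n, x <= y + t ^+ n * C) -> x <= y.
Proof.
move=> /andP[t0 t1] h.
have cv : (fun n => y + t ^+ n * C) @ \oo --> y + 0 * C.
  apply: cvgD; first exact: cvg_cst.
  apply: cvgMr_tmp; apply: cvg_expr; by rewrite ger0_norm.
have -> : y = limn (fun n => y + t ^+ n * C).
  by rewrite (cvg_lim _ cv)// mul0r addr0.
by apply: limr_ge; [exact: cvgP cv|exact: nearW].
Qed.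

(** [D] is the fixed point of [u -> t * u + d]. After [n] iterations the excess over [D] is at most
    [t ^ n] times a constant, so the a priori bound [C] leaves no trace in the limit. *)
Lemma contraction_bound (X : Type) (e : X -> R) (step : X -> X) t d C :
  0 <= t < 1 -> (forall x, `|e x| <= C) ->
  (forall x, `|e x| <= t * `|e (step x)| + d) ->
  forall x, `|e x| <= d / (1 - t).
Proof.
move=> t01 bnd h x; move: (t01) => /andP[t0 t1].
have t1' : 0 < 1 - t by rewrite subr_gt0.
set D := d / (1 - t).
have dE : d = (1 - t) * D by rewrite /D mulrCA divff ?mulr1 // gt_eqF.
apply: (@le_addr_geometric _ _ (C + `|D|) t) => // n.
elim: n x => [|n IH] x.
  rewrite expr0 mul1r addrCA; apply: (le_trans (bnd x)).
  by rewrite lerDl -lerBlDl sub0r -normrN ler_norm.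
apply: (le_trans (h x)).
have /(ler_wpM2l t0) := IH (step x); rewrite dE exprS.
by move: (t ^+ n) `|e _| => p y; nra.
Qed.

Lemma contraction_eq0 (X : Type) (e : X -> R) (step : X -> X) t C :
  0 <= t < 1 -> (forall x, `|e x| <= C) ->
  (forall x, `|e x| <= t * `|e (step x)|) -> forall x, e x = 0.
Proof.
move=> t01 bnd h x; apply/eqP; rewrite -normr_le0 -(mul0r (1 - t)^-1).
by apply: (contraction_bound t01 bnd) => y; rewrite addr0.
Qed.

Lemma is_cvg_digit_series a t : 0 <= t < 1 ->
  cvgn (pseries (fun i => (a i)%:R) t).
Proof.
move=> /andP[t0 t1].
apply: (@series_le_cvg _ _ (geometric 1 t)) => [n|n|n|].
- by rewrite mulr_ge0 ?exprn_ge0.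
- by rewrite /= mul1r exprn_ge0.
- by rewrite /= mul1r ler_piMl ?exprn_ge0 //; case: (a n).
- by apply: is_cvg_geometric_series; rewrite ger0_norm.
Qed.

Lemma digit_series_rec a t : 0 <= t < 1 ->
  digit_series a t = (a 0%N)%:R + t * digit_series (fun k => a k.+1) t.
Proof.
move=> t01; rewrite /digit_series.
have cs := @is_cvg_digit_series (fun k => a k.+1) t t01.
have cv : (fun n => (a 0%N)%:R + t * pseries (fun i => (a i.+1)%:R) t n) @ \oo -->
    (a 0%N)%:R + t * limn (pseries (fun i => (a i.+1)%:R) t).
  apply: cvgD; first exact: cvg_cst.
  by apply: cvgMl_tmp.
apply/cvg_lim => //; rewrite -(cvg_shiftS _).
apply: cvg_trans cv; apply: near_eq_cvg; apply: nearW => n.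
rewrite /pseries /series /= big_nat_recl // expr0 mulr1 mulr_sumr; congr (_ + _).
by apply: eq_bigr => i _; rewrite exprS mulrCA.
Qed.

Lemma digit_series_ge0 a t : 0 <= t < 1 -> 0 <= digit_series a t.
Proof.
move=> t01; apply: limr_ge; first exact: is_cvg_digit_series.
apply: nearW => n; apply: sumr_ge0 => i _.
by case/andP: t01 => t0 _; rewrite mulr_ge0 ?exprn_ge0.
Qed.

Lemma digit_series_le a t : 0 <= t < 1 -> digit_series a t <= (1 - t)^-1.
Proof.
move=> t01; have /andP[t0 t1] := t01.
apply: limr_le; first exact: is_cvg_digit_series.
apply: nearW => n; apply: (@le_trans _ _ (series (geometric 1 t) n)).
  apply: ler_sum => i _; rewrite /= mul1r ler_piMl ?exprn_ge0 //.
  by case: (a i).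
rewrite geometric_seriesE ?lt_eqF //= mul1r ler_piMl //.
  by rewrite invr_ge0 subr_ge0 ltW.
by rewrite gerBl exprn_ge0.
Qed.

(** Subtracting the two recursions leaves [t] times the same difference for the shifted digits, plus
    [(t - r) * y] with [y] at most [1 / (1 - r)]. The contraction runs over digit sequences with the
    shift as [step], so the bound is uniform in [a]. *)
Lemma digit_series_lipschitz a t r : 0 <= t < 1 -> 0 <= r < 1 ->
  `|digit_series a t - digit_series a r| <= `|t - r| / (1 - r) / (1 - t).
Proof.
move=> t01 r01; move: a.
apply: (contraction_bound (step := fun a k => a k.+1)
   (C := (1 - t)^-1 + (1 - r)^-1)) => // a.
  rewrite (le_trans (ler_normB _ _)) // !ger0_norm ?digit_series_ge0 //.
  by rewrite lerD ?digit_series_le.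
rewrite (digit_series_rec a t01) (digit_series_rec a r01).
set x := digit_series _ t; set y := digit_series _ r.
rewrite [X in `|X|](_ : _ = t * (x - y) + (t - r) * y); last by ring.
rewrite (le_trans (ler_normD _ _)) // !normrM.
move: t01 => /andP[t0 t1]; rewrite (ger0_norm t0) lerD2l ler_wpM2l //.
by rewrite ger0_norm ?digit_series_ge0 ?digit_series_le.
Qed.

(** * Exponential growth rates of counting sequences *)

Section ExponentialGrowth.
Variable N : nat -> nat.
Hypothesis N_le : forall m, (N m <= 2 ^ m)%N.

Let u (m : nat) : R := (N m)%:R `^ (m%:R)^-1.

Let u_exp m : (0 < m)%N -> u m ^+ m = (N m)%:R.
Proof.
move=> m0; rewrite -powR_mulrn ?powR_ge0 // /u -powRrM mulVf ?powRr1 //.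
by rewrite pnatr_eq0 -lt0n.
Qed.

Let u_le m r : (0 < m)%N -> 0 <= r -> (u m <= r) = ((N m)%:R <= r ^+ m).
Proof.
by move=> m0 r0; rewrite -(u_exp m0) ler_pXn2r // ?nnegrE ?powR_ge0.
Qed.

Let u_le2 m : u m <= 2.
Proof.
case: m => [|m]; last by rewrite u_le // -natrX ler_nat N_le.
(* At index 0 the exponent [0^-1] is 0, so the value is 1 whatever [N 0] is. *)
by rewrite /u invr0 powRr0 ler1n.
Qed.

Let u_bounded : bounded_fun u.
Proof.
exists 2; split; first exact: num_real.
move=> M M2 m _; rewrite /= ger0_norm ?powR_ge0 //.
by rewrite (le_trans (u_le2 m)) // ltW.
Qed.

Lemma growth_lt r : limn_sup u < r ->
  exists n, forall m, (n <= m)%N -> (N m)%:R <= r ^+ m.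
Proof.
rewrite limn_supE // => /inf_lt[|_ [n _ <-] hn].
  by exists (sups u 0%N); exists 0%N.
(* Index 0 is skipped: [u m ^+ m = N m] requires [0 < m]. *)
exists n.+1 => m nm; have unr : u m <= r.
  apply/ltW/(le_lt_trans _ hn)/ub_le_sup; last by exists m => //=; exact: ltnW.
  by exists 2 => _ [k _ <-]; exact: u_le2.
rewrite -u_le //; first exact: leq_ltn_trans nm.
exact: le_trans (powR_ge0 _ _) unr.
Qed.

(** The constant [C] is absorbed by enlarging [r] to [r + e], because [(r / (r + e)) ^ m] tends to
    0; then [e] is arbitrary. *)
Lemma growth_le r C : 0 < r -> (forall m, (N m)%:R <= C * r ^+ m) ->
  limn_sup u <= r.
Proof.
move=> r0 h; apply/ler_addgt0Pr => e e0.
have re0 : 0 < r + e by rewrite addr_gt0.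
have [n hn] : exists n, forall m, (n <= m)%N -> C * r ^+ m <= (r + e) ^+ m.
  have x1 : `|r / (r + e)| < 1.
    by rewrite ger0_norm ?divr_ge0 ?ltW // ltr_pdivrMr // mul1r ltrDl.
  have := @cvg_geometric R C _ x1 => /cvgrPdist_lt/(_ 1 ltr01)[n _ hn].
  exists n => m nm; have := hn m nm.
  rewrite /= sub0r normrN => /(le_lt_trans (ler_norm _))/ltW.
  by rewrite expr_div_n mulrA ler_pdivrMr ?exprn_gt0 // mul1r.
rewrite limn_supE //; apply: (@le_trans _ _ (sups u n.+1)).
  apply: ge_inf; last by exists n.+1.
  exact: bounded_fun_has_lbound_sups.
apply: ge_sup; first by exists (u n.+1); exists n.+1 => /=.
move=> _ [m /= nm <-]; rewrite u_le ?(ltW re0) //; last exact: leq_ltn_trans nm.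
by rewrite (le_trans (h m)) // hn // ltnW.
Qed.

(** One direction of Fekete's lemma: if [N k < s ^ k], cutting [m] into blocks of length [k] bounds
    [N m] by [2 ^ k * r ^ m] with [r < s], which contradicts the growth rate. *)
Lemma growth_submul k : (forall m n, (N (m + n) <= N m * N n)%N) ->
  1 < limn_sup u -> (0 < k)%N -> limn_sup u ^+ k <= (N k)%:R.
Proof.
move=> Nsub s1 k0; rewrite leNgt; apply/negP => Nk.
set s := limn_sup u in s1 Nk *.
(* The maximum with 1 ensures [1 <= r], hence [r ^ (n * k) <= r ^ m]; as [1 < s], [L] is still below
   [s ^ k]. *)
pose L : R := Num.max 1 (N k)%:R.
have L1 : 1 <= L by rewrite le_max lexx.
pose r := L `^ (k%:R)^-1.
have rk : r ^+ k = L.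
  rewrite -powR_mulrn ?powR_ge0 // -powRrM mulVf ?powRr1 ?(le_trans ler01) //.
  by rewrite pnatr_eq0 -lt0n.
have r1 : 1 <= r by rewrite -(expr_ge1 k0) ?powR_ge0 // rk.
have r0 : 0 < r by rewrite (lt_le_trans ltr01).
have : s <= r.
  apply: (growth_le (C := 2 ^+ k)) => // m.
  have iter n j : (N (n * k + j))%:R <= r ^+ (n * k) * (N j)%:R.
    elim: n => [|n IH]; first by rewrite mul0n expr0 mul1r.
    rewrite mulSn -addnA exprD -mulrA rk.
    apply: (@le_trans _ _ ((N k)%:R * (N (n * k + j))%:R)).
      by rewrite -natrM ler_nat.
    by rewrite ler_pM // le_max lexx orbT.
  rewrite {1}(divn_eq m k); apply: le_trans (iter _ _) _.
  rewrite [leRHS]mulrC; apply: ler_pM => //.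
  - by rewrite exprn_ge0 ?(ltW r0).
  - by rewrite ler_weXn2l // leq_divM.
  - rewrite -natrX ler_nat (leq_trans (N_le _)) // leq_exp2l //.
    by rewrite ltnW // ltn_pmod.
apply/negP; rewrite -ltNge -(ltr_pXn2r k0) ?nnegrE ?(ltW r0) //.
  by rewrite rk gt_max Nk andbT expr_gt1 // (le_trans ler01) // ltW.
by rewrite (le_trans ler01) // ltW.
Qed.

End ExponentialGrowth.
End Analysis.

(** * Laps and crossings of words in two nondecreasing branches *)

Section TwoBranches.
Variables (R : realType) (q : R) (f : bool -> R -> R).
Hypothesis q01 : 0 < q < 1.
Hypothesis f_ndec : forall i (x y : R), x <= y -> f i x <= f i y.
Hypothesis f01 : forall i x, 0 <= f i x <= 1.
Hypothesis f_false : forall x, q <= x -> f false x = f false q.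
Hypothesis f_true : forall x, x <= q -> f true x = f true q.

(** The [m]-th iterate of the transfer operator that sends [b] to the sum of its pullbacks by the
    two branches, acting on functions of a pair of points. *)
Fixpoint word_sum (b : R -> R -> R) (m : nat) (x y : R) : R :=
  if m is m'.+1 then
    word_sum b m' (f false x) (f false y) + word_sum b m' (f true x) (f true y)
  else b x y.

Lemma word_sumD b m n x y :
  word_sum b (m + n) x y = word_sum (word_sum b n) m x y.
Proof. by elim: m x y => [//|m IH] x y; rewrite /= !IH. Qed.

Lemma word_sumM b c m x y :
  word_sum (fun u v => c * b u v) m x y = c * word_sum b m x y.
Proof. by elim: m x y => [//|m IH] x y; rewrite /= !IH mulrDr. Qed.

Lemma ler_word_sum b b' m x y :
  (forall u v : R, 0 <= u -> u <= v -> v <= 1 -> b u v <= b' u v) ->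
  0 <= x -> x <= y -> y <= 1 -> word_sum b m x y <= word_sum b' m x y.
Proof.
move=> bb'; elim: m x y => [|m IH] x y x0 xy y1; first exact: bb'.
have fx i := andP (f01 i x); have fy i := andP (f01 i y).
by apply: lerD; apply: IH; rewrite ?f_ndec //; (case: (fx false); case: (fx true);
  case: (fy false); case: (fy true)).
Qed.

(** For [x <= y] this counts the words of length [m] whose composition is not constant on [[x, y]],
    by monotonicity of the branches. *)
Definition laps := word_sum (fun x y => (x < y)%R%:R).
(** The half-open test agrees with the convention that gives [q] the digit 1. *)
Definition crossings := word_sum (fun x y => (x < q <= y)%R%:R).

Lemma crossingsS m x y : crossings m.+1 x y =
  crossings m (f false x) (f false y) + crossings m (f true x) (f true y).
Proof. by []. Qed.

Lemma crossings_ge0 m x y : 0 <= crossings m x y.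
Proof.
by rewrite /crossings; elim: m x y => [|m IH] x y /=; rewrite ?addr_ge0.
Qed.

Lemma laps_diag m x : laps m x x = 0.
Proof.
rewrite /laps; elim: m x => [|m IH] x /=; first by rewrite ltxx.
by rewrite !IH addr0.
Qed.

Lemma laps_mono m x y x' y' : x' <= x -> y <= y' -> laps m x y <= laps m x' y'.
Proof.
rewrite /laps; elim: m x y x' y' => [|m IH] x y x' y' xx yy /=; last first.
  by rewrite lerD // IH // f_ndec.
rewrite ler_nat; case: ltP => //= xy.
by rewrite (le_lt_trans xx) // (lt_le_trans xy).
Qed.

(** A word contributes only if its prefix of length [m] separates 0 from 1; its suffix must then
    separate two points of [[0, 1]], which at most [laps n 0 1] suffixes do. *)
Lemma laps_submul m n : laps (m + n) 0 1 <= laps m 0 1 * laps n 0 1.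
Proof.
rewrite /laps word_sumD mulrC -word_sumM.
apply: ler_word_sum => // u v u0 uv v1; rewrite -/(laps n u v) -/(laps n 0 1).
move: uv; rewrite le_eqVlt => /predU1P[->|uv].
  by rewrite laps_diag ltxx mulr0.
by rewrite uv mulr1 laps_mono.
Qed.

(* Outside a crossing one of the two branches is constant between x and y. *)
Lemma laps_le_crossings m x y : x <= y ->
  laps m x y <= 1 + \sum_(j < m) crossings j x y.
Proof.
rewrite /laps; elim: m x y => [|m IH] x y xy /=.
  by rewrite big_ord0 addr0 lern1 leq_b1.
have IH0 := IH _ _ (f_ndec false xy); have IH1 := IH _ _ (f_ndec true xy).
rewrite -/(laps m) in IH0 IH1 *.
rewrite big_ord_recl {1}/crossings /= [X in _ + (_ + X)](_ : _ =
  \sum_(j < m) crossings j (f false x) (f false y) +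
  \sum_(j < m) crossings j (f true x) (f true y)); last by rewrite -big_split.
set S0 := \sum_(j < m) _ in IH0 *; set S1 := \sum_(j < m) _ in IH1 *.
have S0_ge0 : 0 <= S0 by apply: sumr_ge0 => j _; exact: crossings_ge0.
have S1_ge0 : 0 <= S1 by apply: sumr_ge0 => j _; exact: crossings_ge0.
case: (leP q y) => qy; rewrite ?andbT ?andbF /=; last first.
  rewrite (f_true (ltW qy)) (f_true (le_trans xy (ltW qy))) laps_diag; lra.
case: (ltP x q) => xq /=; first by lra.
by rewrite (f_false xq) (f_false qy) laps_diag; lra.
Qed.

(** * Itineraries and their generating functions *)

Definition digit c x : bool := if c then q <= x else q < x.
Definition step c x := f (digit c x) x.
(** [c] is the digit given to [q] itself: from [x = q], [c = false] yields alpha and [c = true]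
    yields beta. *)
Definition itinerary c x k := digit c (iter k (step c) x).
Definition itinerary_series c (t x : R) := digit_series (itinerary c x) t.

Section FixedParameter.
Variable t : R.
Hypothesis t01 : 0 <= t < 1.

Let t0 : 0 <= t. Proof. by case/andP: t01. Qed.

Lemma itinerary_series_rec c x : itinerary_series c t x =
  (digit c x)%:R + t * itinerary_series c t (step c x).
Proof.
rewrite /itinerary_series.
have -> : itinerary c (step c x) = fun k => itinerary c x k.+1.
  by apply/funext => k; rewrite /itinerary iterSr.
exact: digit_series_rec.
Qed.

Lemma itinerary_series_ge0 c x : 0 <= itinerary_series c t x.
Proof. exact: digit_series_ge0. Qed.

Lemma itinerary_series_le c x : itinerary_series c t x <= (1 - t)^-1.
Proof. exact: digit_series_le. Qed.

Local Notation H := (itinerary_series true t).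

(* H obeys the right branch equation at q by the choice of digit there; this is
   its defect in the left branch equation, which vanishes exactly when the two
   critical series agree. *)
Definition jump := H q - t * H (f false q).

Lemma series_diff_bound c c' x y :
  `|itinerary_series c t x - itinerary_series c' t y| <= (1 - t)^-1.
Proof.
have := itinerary_series_ge0 c x; have := itinerary_series_le c x.
have := itinerary_series_ge0 c' y; have := itinerary_series_le c' y.
by rewrite ler_norml; lra.
Qed.

(** Off [q] both conventions use the same branch, so their difference [e] satisfies
    [e x = t * e (step x)]. A zero jump gives this at [q] too, and contraction forces [e = 0].
    Conversely, [e q = 0] makes the inequality trivial at [q]; then [e] vanishes at [f false q],
    which is the left branch equation at [q]. *)
Lemma jump_eq0 :
  jump = 0 <-> itinerary_series false t q = itinerary_series true t q.
Proof.
pose e x := H x - itinerary_series false t x.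
have digit_neq c x : x != q -> digit c x = (q < x).
  by move=> xq; case: c => //=; rewrite /digit le_eqVlt eq_sym (negPf xq).
have e_neq c x : x != q -> e x = t * e (step c x).
  move=> xq; rewrite /e (itinerary_series_rec true x) (itinerary_series_rec false x).
  by rewrite /step !(digit_neq _ _ xq) opprD addrACA subrr add0r -mulrBr.
split=> [j0|eq].
- suff : e q = 0 by move/eqP; rewrite subr_eq0 => /eqP.
  apply: (contraction_eq0 (step := step false) t01 (C := (1 - t)^-1)) => x.
    exact: series_diff_bound.
  have [->|xq] := eqVneq x q; last by rewrite (e_neq false) // normrM ger0_norm.
  rewrite /e (itinerary_series_rec false) /step /digit ltxx /= add0r.
  by move/eqP: j0; rewrite subr_eq0 => /eqP ->; rewrite -mulrBr normrM ger0_norm.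
- have /(_ (f false q)) : forall x, e x = 0.
    apply: (contraction_eq0 (step := step false) t01 (C := (1 - t)^-1)) => x.
      exact: series_diff_bound.
    have [->|xq] := eqVneq x q; last by rewrite (e_neq false) // normrM ger0_norm.
    by rewrite {1}/e eq subrr normr0 mulr_ge0.
  move/eqP; rewrite subr_eq0 /jump => /eqP ->; rewrite -eq.
  by rewrite (itinerary_series_rec false q) /step /digit ltxx add0r subrr.
Qed.

Lemma series_false x : x < q -> H x = t * H (f false x).
Proof.
by move=> xq; rewrite itinerary_series_rec /step /digit leNgt xq add0r.
Qed.

Lemma series_true x : q <= x -> H x = 1 + t * H (f true x).
Proof. by move=> xq; rewrite itinerary_series_rec /step /digit xq. Qed.

Let dH x y := H y - H x.

(** Without a crossing, one branch is constant and drops out. With one, the increment is split at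
    [q]: since [f false y = f false q] and [f true x = f true q], both pieces are full branch
    increments, and the mismatch at [q] is [jump]. *)
Lemma series_increment x y : x <= y ->
  dH x y = jump * crossings 0 x y + t * word_sum dH 1 x y.
Proof.
move=> xy; rewrite /dH /jump /crossings /=.
case: (ltP x q) => xq; case: (leP q y) => qy; rewrite ?mulr1 ?mulr0 /=.
- rewrite (series_true qy) (series_true (lexx q)) (series_false xq).
  by rewrite (f_false qy) (f_true (ltW xq)); ring.
- rewrite (series_false xq) (series_false qy) (f_true (ltW xq)) (f_true (ltW qy)); ring.
- rewrite (series_true xq) (series_true qy) (f_false xq) (f_false qy); ring.
- by have := lt_le_trans qy xq; rewrite ltNge xy.
Qed.

Lemma word_sum_increment m x y : x <= y ->
  word_sum dH m x y = jump * crossings m x y + t * word_sum dH m.+1 x y.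
Proof.
elim: m x y => [|m IH] x y xy; first exact: series_increment.
rewrite crossingsS /= !(IH _ _ (f_ndec _ xy)) /=; ring.
Qed.

Lemma series_increment_iter m x y : x <= y ->
  dH x y = jump * (\sum_(j < m) t ^+ j * crossings j x y)
           + t ^+ m * word_sum dH m x y.
Proof.
move=> xy; elim: m => [|m IH]; first by rewrite big_ord0 expr0 mulr0 mul1r add0r.
rewrite IH big_ord_recr /= (word_sum_increment _ xy) exprSr /=; ring.
Qed.

(** An increment of [H] is at most [1 / (1 - t)] in absolute value and is zero when the word
    identifies the two points, so only laps contribute. *)
Lemma word_sum_increment_le m x y : 0 <= x -> x <= y -> y <= 1 ->
  `|word_sum dH m x y| <= (1 - t)^-1 * laps m 0 1.
Proof.
move=> x0 xy y1.
apply: (@le_trans _ _ ((1 - t)^-1 * laps m x y)); last first.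
  rewrite ler_wpM2l ?laps_mono // invr_ge0 subr_ge0.
  by case/andP: t01 => _ /ltW.
have b u v : u <= v -> `|dH u v| <= (1 - t)^-1 * (u < v)%R%:R.
  rewrite le_eqVlt => /predU1P[->|uv]; first by rewrite /dH subrr ltxx normr0 mulr0.
  by rewrite uv mulr1 series_diff_bound.
rewrite ler_norml; apply/andP; split.
  rewrite -mulNr /laps -word_sumM; apply: ler_word_sum => // u v _ uv _.
  by have := b u v uv; rewrite ler_norml mulNr => /andP[].
rewrite /laps -word_sumM; apply: ler_word_sum => // u v _ uv _.
by have := b u v uv; rewrite ler_norml => /andP[].
Qed.

(** * Monotonicity below the critical parameter *)

Section Subcritical.
Variables (rho : R) (n : nat).
Hypothesis rho01 : 0 <= rho < 1.
Hypothesis decay : forall m, (n <= m)%N -> t ^+ m * laps m 0 1 <= rho ^+ m.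

(** The shift by [n] puts every length past the threshold of [decay]; [rho ^+ n] joins the
    constant. *)
Let remainder m x y : 0 <= x -> x <= y -> y <= 1 ->
  `|t ^+ (m + n) * word_sum dH (m + n) x y| <= rho ^+ m * (rho ^+ n / (1 - t)).
Proof.
move=> x0 xy y1; rewrite normrM ger0_norm ?exprn_ge0 //.
rewrite (le_trans (ler_wpM2l _ (word_sum_increment_le _ x0 xy y1))) ?exprn_ge0 //.
rewrite [leRHS]mulrA -exprD mulrCA [leLHS]mulrC ler_wpM2r ?decay ?leq_addl //.
by rewrite invr_ge0 subr_ge0; case/andP: t01 => _ /ltW.
Qed.

Let sum_ge0 m x y : 0 <= \sum_(j < m) t ^+ j * crossings j x y.
Proof. by apply: sumr_ge0 => j _; rewrite mulr_ge0 ?exprn_ge0 ?crossings_ge0. Qed.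

Let increment_bound (A B E a b : R) :
  b - a = A + B -> `|B| <= E -> (0 <= A -> a <= b + E) /\ (A <= 0 -> b <= a + E).
Proof. by rewrite ler_norml => eq /andP[lo up]; split=> ?; lra. Qed.

Lemma series_ndec_subcritical (x y : R) : 0 <= jump -> 0 <= x -> x <= y -> y <= 1 ->
  H x <= H y.
Proof.
move=> j0 x0 xy y1; apply: (le_addr_geometric rho01) => m.
have [+ _] := increment_bound (series_increment_iter (m + n) xy)
  (remainder m x0 xy y1).
by apply; rewrite mulr_ge0.
Qed.

Lemma series_ninc_subcritical (x y : R) : jump <= 0 -> 0 <= x -> x <= y -> y <= 1 ->
  H y <= H x.
Proof.
move=> j0 x0 xy y1; apply: (le_addr_geometric rho01) => m.
have [_] := increment_bound (series_increment_iter (m + n) xy)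
  (remainder m x0 xy y1).
by apply; rewrite mulr_le0_ge0.
Qed.

(** If the jump were nonpositive, [H] would be nonincreasing on [[0, 1]]. Then [H 0 >= H q >= 1],
    while [H 0 = t * H (f false 0) <= t * H 0] forces [H 0 <= 0]. *)
Lemma jump_gt0_subcritical : 0 < jump.
Proof.
have /andP[q0 q1] := q01; rewrite ltNge; apply/negP => j0.
have /andP[f0 f1] := f01 false 0.
have h1 : H (f false 0) <= H 0 by apply: series_ninc_subcritical.
have h2 : H q <= H 0 by apply: series_ninc_subcritical => //; exact: ltW.
have h3 : 1 <= H q.
  by rewrite series_true // lerDl mulr_ge0 ?itinerary_series_ge0.
have := series_false q0; have := itinerary_series_ge0 true 0.
case/andP: t01; move: (H 0) (H q) (H (f false 0)) h1 h2 h3 => *; nra.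
Qed.

End Subcritical.
End FixedParameter.

(** * Continuity of the generating function when the jump vanishes *)

Section Continuity.
Variable t : R.
Hypothesis t01 : 0 <= t < 1.
Hypothesis jump0 : jump t = 0.
Hypothesis f_cont : forall i, continuous (f i).
Local Notation H := (itinerary_series true t).
Hypothesis H_ndec01 : forall x y : R, 0 <= x -> x <= y -> y <= 1 -> H x <= H y.

Let t0 : 0 <= t. Proof. by case/andP: t01. Qed.

Lemma series_false_le x : x <= q -> H x = t * H (f false x).
Proof.
rewrite le_eqVlt => /predU1P[->|/series_false//]; last exact.
by apply/eqP; rewrite -subr_eq0 -/(jump t) jump0.
Qed.

(** Monotonicity extends from [[0, 1]] to the whole line because one application of the branches
    lands in [[0, 1]]. *)
Lemma series_ndec (x y : R) : x <= y -> H x <= H y.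
Proof.
move=> xy; rewrite -subr_ge0 (series_increment t01 xy) jump0 mul0r add0r /=.
have b i := H_ndec01 (proj1 (andP (f01 i x))) (f_ndec i xy)
  (proj2 (andP (f01 i y))).
by rewrite mulr_ge0 // addr_ge0 // subr_ge0 b.
Qed.

Let increment_le i x y z m : 0 <= t ->
  H y - H x = t * (H (f i y) - H (f i x)) -> H (f i y) <= H z ->
  H z - H (f i x) <= t ^+ m * (1 - t)^-1 ->
  H y - H x <= t ^+ m.+1 * (1 - t)^-1.
Proof.
move=> t_ge0 -> yz zx; rewrite exprS -mulrA ler_wpM2l //.
by apply: le_trans zx; rewrite lerD2r.
Qed.

(** Close to [x] on the right a single branch governs [H], so an oscillation bound at [f i x]
    returns to [x] with an additional factor [t]. *)
Lemma series_right_continuous m (x : R) :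
  exists2 y, x < y & H y - H x <= t ^+ m * (1 - t)^-1.
Proof.
elim: m x => [|m IH] x.
  exists (x + 1); first by rewrite ltrDl.
  by rewrite mul1r (le_trans (ler_norm _)) ?series_diff_bound.
have [xq|qx] := ltP x q.
- have [z xz hz] := IH (f false x).
  have [y [xy yq yz]] : exists y, [/\ x < y, y <= q & f false y < z].
    near x^'+ => y; exists y; split.
    + by near: y; exact: nbhs_right_gt.
    + by near: y; exact: nbhs_right_le.
    + near: y; apply: cvgr_lt xz; apply: cvg_at_right_filter; exact: f_cont false x.
  exists y => //; apply: increment_le t0 _ (series_ndec (ltW yz)) hz.
  by rewrite (series_false_le yq) (series_false t01 xq) mulrBr.
- have [z xz hz] := IH (f true x).
  have [y [xy yz]] : exists y, x < y /\ f true y < z.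
    near x^'+ => y; exists y; split.
    + by near: y; exact: nbhs_right_gt.
    + near: y; apply: cvgr_lt xz; apply: cvg_at_right_filter; exact: f_cont true x.
  exists y => //; apply: increment_le t0 _ (series_ndec (ltW yz)) hz.
  rewrite (series_true t01 qx) (series_true t01 (le_trans qx (ltW xy))).
  by rewrite opprD addrACA subrr add0r mulrBr.
Unshelve. all: by end_near. Qed.

Let decrement_le i x y z m : 0 <= t ->
  H x - H y = t * (H (f i x) - H (f i y)) -> H z <= H (f i y) ->
  H (f i x) - H z <= t ^+ m * (1 - t)^-1 ->
  H x - H y <= t ^+ m.+1 * (1 - t)^-1.
Proof.
move=> t_ge0 -> yz zx; rewrite exprS -mulrA ler_wpM2l //.
by apply: le_trans zx; rewrite lerD2l lerN2.
Qed.

(** The mirror argument. At [x = q] it relies on the left branch equation, available there because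
    the jump vanishes. *)
Lemma series_left_continuous m (x : R) :
  exists2 y, y < x & H x - H y <= t ^+ m * (1 - t)^-1.
Proof.
elim: m x => [|m IH] x.
  exists (x - 1); first by rewrite ltrBlDr ltrDl.
  by rewrite mul1r (le_trans (ler_norm _)) ?series_diff_bound.
have [xq|qx] := leP x q.
- have [z xz hz] := IH (f false x).
  have [y [xy yz]] : exists y, y < x /\ z < f false y.
    near x^'- => y; exists y; split.
    + by near: y; exact: nbhs_left_lt.
    + near: y; apply: cvgr_gt xz; apply: cvg_at_left_filter; exact: f_cont false x.
  exists y => //; apply: decrement_le t0 _ (series_ndec (ltW yz)) hz.
  rewrite (series_false_le xq) (series_false t01 (lt_le_trans xy xq)).
  by rewrite mulrBr.
- have [z xz hz] := IH (f true x).
  have [y [xy yq yz]] : exists y, [/\ y < x, q <= y & z < f true y].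
    near x^'- => y; exists y; split.
    + by near: y; exact: nbhs_left_lt.
    + by near: y; exact: nbhs_left_ge.
    + near: y; apply: cvgr_gt xz; apply: cvg_at_left_filter; exact: f_cont true x.
  exists y => //; apply: decrement_le t0 _ (series_ndec (ltW yz)) hz.
  rewrite (series_true t01 yq) (series_true t01 (ltW qx)).
  by rewrite opprD addrACA subrr add0r mulrBr.
Unshelve. all: by end_near. Qed.

Lemma series_continuous : continuous H.
Proof.
move=> x; apply/cvgrPdist_le => e e0.
have [m hm] : exists m, t ^+ m * (1 - t)^-1 <= e.
  have tn : `|t| < 1 by rewrite ger0_norm //; case/andP: t01.
  have /cvgrPdist_lt/(_ e e0)[n _ hn] := cvg_geometric (1 - t)^-1 tn.
  exists n; have := hn n (leqnn n); rewrite /= sub0r normrN mulrC.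
  by move=> /(le_lt_trans (ler_norm _))/ltW.
have [y xy hy] := series_right_continuous m x.
have [w wx hw] := series_left_continuous m x.
near=> z.
have wz : w <= z by apply/ltW; near: z; exact: lt_nbhsr.
have zy : z <= y by apply/ltW; near: z; exact: lt_nbhsl.
have := series_ndec wz; have := series_ndec zy.
by rewrite ler_norml => h1 h2; apply/andP; split;
  move: (H x) (H y) (H z) (H w) hm hy hw h1 h2 => *; lra.
Unshelve. all: by end_near. Qed.

End Continuity.

(** * Passage to the critical parameter [s^-1] *)

Section Critical.
Variable s : R.
Hypothesis s_gt1 : 1 < s.
Hypothesis decay : forall t : R, 0 < t -> t * s < 1 -> exists (rho : R) n,
  0 <= rho < 1 /\ forall m, (n <= m)%N -> t ^+ m * laps m 0 1 <= rho ^+ m.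
Hypothesis laps_ge : forall m, s ^+ m <= laps m 0 1.

Let s_gt0 : 0 < s. Proof. exact: lt_trans s_gt1. Qed.

Let si01 : 0 <= s^-1 < 1.
Proof. by rewrite invr_ge0 ltW //= invf_lt1. Qed.

Lemma lt_inv_lt1 (t : R) : 0 < t < s^-1 -> 0 <= t < 1.
Proof.
by case/andP=> t0 ts; rewrite ltW //=; case/andP: si01 => _; apply: lt_trans.
Qed.

Lemma jump_gt0 (t : R) : 0 < t < s^-1 -> 0 < jump t.
Proof.
move=> ts; have t01 := lt_inv_lt1 ts; case/andP: ts => t0.
rewrite -[s^-1]mul1r ltr_pdivlMr // => /(decay t0)[rho [n [rho01 h]]].
exact (jump_gt0_subcritical t01 rho01 h).
Qed.

Lemma series_ndec_lt (t x y : R) : 0 < t < s^-1 -> 0 <= x -> x <= y -> y <= 1 ->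
  itinerary_series true t x <= itinerary_series true t y.
Proof.
move=> ts; have t01 := lt_inv_lt1 ts; have /ltW j0 := jump_gt0 ts.
case/andP: ts => t0.
rewrite -[s^-1]mul1r ltr_pdivlMr // => /(decay t0)[rho [n [rho01 h]]].
exact (series_ndec_subcritical t01 rho01 h j0).
Qed.

(** Carries the subcritical inequalities to [s^-1]: the Lipschitz bound makes [G] left continuous at
    [r]. *)
Lemma ge0_left_limit (G : R -> R) (K r : R) : 0 < r ->
  (forall t : R, 0 < t < r -> 0 <= G t) ->
  (forall t : R, 0 < t < r -> `|G t - G r| <= K * (r - t)) -> 0 <= G r.
Proof.
move=> r0 G0 GK; apply/ler_addgt0Pr => e e0.
have K0 : 0 < `|K| + 1 by rewrite ltr_wpDl.
pose d := Num.min (r / 2) (e / (`|K| + 1)).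
have d0 : 0 < d by rewrite lt_min !divr_gt0.
have dr : d < r.
  by rewrite gt_min ltr_pdivrMr // mulr_natr mulr2n ltrDl r0.
have dr' : 0 < r - d < r by rewrite subr_gt0 dr gtrBl d0.
have /(le_trans (ler_norm _)) := GK _ dr'; have := G0 _ dr'.
rewrite subKr => h1 h2.
suff : K * d <= e by move: h1 h2; lra.
apply: (@le_trans _ _ ((`|K| + 1) * d)).
  rewrite ler_wpM2r ?(ltW d0) //; have := ler_norm K; lra.
by rewrite mulrC -ler_pdivlMr // ge_min lexx orbT.
Qed.

Let lipschitz_bound (t r : R) : 0 < t < r -> r < 1 ->
  `|t - r| / (1 - r) / (1 - t) <= ((1 - r)^-1 * (1 - r)^-1) * (r - t).
Proof.
move=> /andP[t0 tr] r1; rewrite distrC ger0_norm ?subr_ge0 ?(ltW tr) //.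
have r1' : 0 < 1 - r by rewrite subr_gt0.
have t1' : 0 < 1 - t by rewrite subr_gt0 (lt_trans tr).
rewrite [leRHS]mulrC -[leLHS]mulrA ler_wpM2l ?subr_ge0 ?(ltW tr) //.
by rewrite ler_wpM2l ?invr_ge0 ?(ltW r1') // lef_pV2 ?posrE // lerB // ltW.
Qed.

Lemma series_lipschitz c (x t : R) : 0 < t < s^-1 ->
  `|itinerary_series c t x - itinerary_series c s^-1 x| <=
  ((1 - s^-1)^-1 * (1 - s^-1)^-1) * (s^-1 - t).
Proof.
move=> ts; apply: le_trans (lipschitz_bound ts _); last by case/andP: si01.
exact: digit_series_lipschitz (lt_inv_lt1 ts) si01.
Qed.

Local Notation H := (itinerary_series true s^-1).

Lemma series_ndec_critical (x y : R) : 0 <= x -> x <= y -> y <= 1 -> H x <= H y.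
Proof.
move=> x0 xy y1; rewrite -subr_ge0.
set L := (1 - s^-1)^-1 * (1 - s^-1)^-1.
apply: (@ge0_left_limit
  (fun t => itinerary_series true t y - itinerary_series true t x) (L + L)).
- by rewrite invr_gt0.
- by move=> t ts; rewrite subr_ge0 series_ndec_lt.
- move=> t ts; have hx := series_lipschitz true x ts.
  have hy := series_lipschitz true y ts.
  rewrite mulrDl; apply: le_trans (lerD hy hx).
  by apply: le_trans (ler_normB _ _); rewrite !opprD !opprK addrACA.
Qed.

Lemma jump_ge0_critical : 0 <= jump s^-1.
Proof.
set L := (1 - s^-1)^-1 * (1 - s^-1)^-1.
apply: (@ge0_left_limit jump (L + (L + (1 - s^-1)^-1))).
- by rewrite invr_gt0.
- by move=> t /jump_gt0/ltW.
- move=> t ts; have h1 := series_lipschitz true q ts.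
  have h2 := series_lipschitz true (f false q) ts.
  have t01 := lt_inv_lt1 ts; have /andP[t0 t1] := t01.
  rewrite /jump; move: h1 h2.
  have := itinerary_series_ge0 si01 true (f false q).
  have := itinerary_series_le si01 true (f false q).
  rewrite -/L; set C := (1 - s^-1)^-1.
  move: (itinerary_series true t q) (itinerary_series true t (f false q)).
  move: (H q) (H (f false q)) => a b c d bC b0 ca db.
  (* The three terms account for the change of [H q], the change of [H (f false q)], and the change
     of the factor in front of the latter. *)
  rewrite (_ : _ - _ = (c - a) + (t * (b - d) + (s^-1 - t) * b)); last by ring.
  rewrite [leRHS]mulrDl (le_trans (ler_normD _ _)) // lerD // [leRHS]mulrDl.
  rewrite (le_trans (ler_normD _ _)) // lerD // !normrM.
    rewrite distrC (ger0_norm t0); apply: le_trans db.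
    by rewrite ler_piMl // ltW.
  rewrite [leRHS]mulrC ler_pM // ger0_norm // subr_ge0 ltW //.
  by case/andP: ts.
Qed.

(** Summation by parts, relating the weighted sum of [K] to that of its partial sums, the form in
    which crossings bound laps. *)
Let abel_sum (K : nat -> R) (t : R) M :
  (1 - t) * (\sum_(m < M) t ^+ m * (1 + \sum_(j < m) K j)) =
  1 + t * (\sum_(m < M) t ^+ m * K m) - t ^+ M * (1 + \sum_(j < M) K j).
Proof.
elim: M => [|M IH]; first by rewrite !big_ord0 expr0; ring.
rewrite big_ord_recr /= mulrDr IH !big_ord_recr /= exprS; ring.
Qed.

(* A positive jump would bound the weighted number of crossings uniformly,
   hence (Abel summation) also the sum of laps m 0 1 / s ^ m, whose terms are
   at least 1. *)
Lemma jump_critical : jump s^-1 = 0.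
Proof.
apply/eqP; rewrite eq_le jump_ge0_critical andbT leNgt; apply/negP => j0.
set t := s^-1 in j0 *; set C := (1 - t)^-1.
have t0 : 0 < t by rewrite invr_gt0.
have t1 : 0 < 1 - t by rewrite subr_gt0; case/andP: si01.
have crossings_bound M : \sum_(j < M) t ^+ j * crossings j 0 1 <= C / jump t.
  rewrite ler_pdivlMr // mulrC.
  have := series_increment_iter si01 M ler01.
  have := series_diff_bound si01 true true 1 0.
  move=> /(le_trans (ler_norm _)) hC eq.
  have : 0 <= word_sum (fun x y => H y - H x) M 0 1.
    rewrite -[leLHS](mul0r (word_sum (fun x y => H y - H x) M 0 1)) -word_sumM.
    apply: ler_word_sum => // u v u0 uv v1.
    by rewrite mul0r subr_ge0 series_ndec_critical.
  move=> /(mulr_ge0 (exprn_ge0 M (ltW t0))) h.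
  by apply: le_trans hC; rewrite eq lerDl.
pose B := (1 + t * (C / jump t)) / (1 - t).
have bound M : M%:R <= B.
  rewrite ler_pdivlMr // mulrC.
  have : \sum_(m < M) (1 : R) <=
      \sum_(m < M) t ^+ m * (1 + \sum_(j < m) crossings j 0 1).
    apply: ler_sum => m _.
    rewrite -[leLHS](mulVf (lt0r_neq0 (exprn_gt0 m s_gt0))) -exprVn.
    rewrite ler_wpM2l ?exprn_ge0 ?(ltW t0) // (le_trans (laps_ge m)) //.
    exact (laps_le_crossings m ler01).
  rewrite sumr_const card_ord => /(ler_wpM2l (ltW t1)).
  move=> /le_trans; apply.
  rewrite (abel_sum (fun j => crossings j 0 1)).
  rewrite lerBlDr -addrA lerD2l; apply: ler_wpDr.
    rewrite mulr_ge0 ?exprn_ge0 ?(ltW t0) // addr_ge0 // sumr_ge0 // => j _.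
    exact: crossings_ge0.
  by rewrite ler_wpM2l ?(ltW t0).
have := archi_boundP (le_trans (ler0n _ 0) (bound 0%N)).
by rewrite ltNge bound.
Qed.

End Critical.

End TwoBranches.

(** * Counting words by their first letter *)

Lemma card_tupleS (P : pred (seq bool)) m :
  #|[pred w : m.+1.-tuple bool | P w]| =
  (#|[pred w : m.-tuple bool | P (false :: w)]| +
   #|[pred w : m.-tuple bool | P (true :: w)]|)%N.
Proof.
rewrite -!sum1_card (reindex
  (fun p : bool * m.-tuple bool => [tuple of p.1 :: p.2])) /=.
  rewrite -(pair_big_dep xpredT (fun i (w : m.-tuple bool) => P (i :: w))
    (fun _ _ => 1%N)) /=.
  by rewrite big_bool addnC.
exists (fun w => (thead w, [tuple of behead w])) => [[i w] _|w _] /=.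
  by congr pair; apply/val_inj.
by rewrite [w in RHS]tuple_eta; apply/val_inj.
Qed.

Lemma card_words_laps (R : realType) (f : bool -> R -> R) m (x y : R) :
  #|[pred w : m.-tuple bool | foldl (fun z i => f i z) x w <
      foldl (fun z i => f i z) y w]|%:R = laps f m x y.
Proof.
rewrite /laps; elim: m x y => [|m IH] x y /=; last first.
  rewrite (card_tupleS (fun w => foldl (fun z i => f i z) x w <
    foldl (fun z i => f i z) y w)) natrD.
  by rewrite -!IH.
rewrite -sum1_card big_mkcond /= (big_pred1 [tuple]) /=; last first.
  by move=> w; apply/esym/eqP; exact: tuple0.
by rewrite inE /=; case: (x < y).
Qed.

(** [word_comp] is a left fold and grows at the last letter; this peels off the first one, as the
    inductions on words require. *)
Lemma word_comp_cons (R : realType) (F : bool -> partial_map R) i w :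
  (forall x, word_comp F (i :: w) x = word_comp F w (F i x)) /\
  (forall x, pdom (word_comp F (i :: w)) x <->
             pdom (F i) x /\ pdom (word_comp F w) (F i x)).
Proof.
elim/last_ind: w => [|w j [IHv IHd]].
  by split=> // x; split=> [[]|[]].
rewrite -rcons_cons /word_comp !foldl_rcons -!/(word_comp F _); split=> x /=.
  by rewrite IHv.
rewrite IHv; split.
  by move=> [/IHd[? ?] ?].
by move=> [? [? ?]]; split=> //; apply/IHd.
Qed.

(** * Extension of the partial maps to total branches, and domains of words *)

Section LorenzSystem.
Variables (R : realType) (q : R) (F : bool -> partial_map R).
Hypothesis q01 : 0 < q < 1.
Hypothesis F_system : is_system F.
Hypothesis dom_false : pdom (F false) = `[0, q]%classic.
Hypothesis dom_true : pdom (F true) = `[q, 1]%classic.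
Hypothesis F_false : [/\ 0 <= F false 0, F false 0 < F false q & F false q <= 1].
Hypothesis F_true : [/\ 0 <= F true q, F true q < F true 1 & F true 1 <= 1].

Definition left_end i : R := if i then q else 0.
Definition right_end i : R := if i then 1 else q.
Definition clip i x : R := Num.max (left_end i) (Num.min x (right_end i)).
(* Each branch is extended to a total map, constant outside its domain. *)
Definition branch i x := F i (clip i x).

Lemma ends_lt i : left_end i < right_end i.
Proof. by case: i; case/andP: q01. Qed.

Lemma left_end_ge0 i : 0 <= left_end i.
Proof. by case: i => //=; case/andP: q01 => /ltW. Qed.

Lemma right_end_le1 i : right_end i <= 1.
Proof. by case: i => //=; case/andP: q01 => _ /ltW. Qed.

Lemma pdomE i x : pdom (F i) x <-> left_end i <= x <= right_end i.
Proof. by case: i; rewrite ?dom_false ?dom_true /= in_itv. Qed.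

Lemma clip_dom i x : left_end i <= clip i x <= right_end i.
Proof.
by rewrite le_max lexx /= ge_max ge_min lexx orbT andbT ltW // ends_lt.
Qed.

Lemma clip_id i x : left_end i <= x <= right_end i -> clip i x = x.
Proof. by case/andP=> lx xr; rewrite /clip min_l // max_r. Qed.

Lemma clip_le i x : clip i x = left_end i \/ clip i x <= x.
Proof.
rewrite /clip maxEge; case: ifP => [_|_]; first by left.
by right; rewrite ge_min lexx.
Qed.

Lemma clip_mono i x y : x <= y -> clip i x <= clip i y.
Proof. by move=> xy; rewrite /clip le_max2 // le_min2. Qed.

Lemma branch_dom i x : left_end i <= x <= right_end i -> branch i x = F i x.
Proof. by move=> h; rewrite /branch clip_id. Qed.

(** A system also allows decreasing maps; the assumed order of the endpoint values excludes them. *)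
Lemma F_mono i x y : left_end i <= x -> x < y -> y <= right_end i ->
  F i x < F i y.
Proof.
move=> lx xy yr; have [_ _ [inc|dec]] := F_system i.
  by apply: inc => //; apply/pdomE; rewrite ?lx ?yr ?(ltW (lt_le_trans xy yr))
    ?(ltW (le_lt_trans lx xy)).
have : F i (right_end i) < F i (left_end i).
  by apply: dec; rewrite ?ends_lt //; apply/pdomE; rewrite lexx ltW ?ends_lt.
have : F i (left_end i) < F i (right_end i).
  by case: (i); [case: F_true|case: F_false].
by move=> /lt_trans h /h; rewrite ltxx.
Qed.

Lemma F_mono_le i x y : left_end i <= x -> x <= y -> y <= right_end i ->
  F i x <= F i y.
Proof.
by move=> lx; rewrite le_eqVlt => /predU1P[->//|xy yr]; exact/ltW/F_mono.
Qed.

Lemma branch_ndec i x y : x <= y -> branch i x <= branch i y.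
Proof.
move=> xy; have /andP[lx _] := clip_dom i x; have /andP[_ yr] := clip_dom i y.
by apply: F_mono_le => //; exact: clip_mono.
Qed.

Lemma branch01 i x : 0 <= branch i x <= 1.
Proof.
have /andP[lx xr] := clip_dom i x; have /ltW lr := ends_lt i.
have lo : F i (left_end i) <= branch i x by exact: F_mono_le.
have hi : branch i x <= F i (right_end i) by exact: F_mono_le.
have : 0 <= F i (left_end i) /\ F i (right_end i) <= 1.
  by case: (i); [case: F_true|case: F_false].
by case=> l0 r1; rewrite (le_trans l0 lo) (le_trans hi r1).
Qed.

Lemma branch_false x : q <= x -> branch false x = branch false q.
Proof. by move=> qx; rewrite /branch /clip /= min_r // minxx. Qed.

Lemma branch_true x : x <= q -> branch true x = branch true q.
Proof.
move=> xq; have /andP[_ q1] := q01.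
by rewrite /branch /clip /= !min_l ?(ltW q1) ?(le_trans xq (ltW q1)) // maxxx max_l.
Qed.

(** [F i] is continuous only within its domain, but [clip i] is a continuous retraction onto that
    domain. *)
Lemma branch_continuous i : continuous (branch i).
Proof.
move=> x; have [_ cF _] := F_system i.
have cx : pdom (F i) (clip i x) by apply/pdomE; exact: clip_dom.
move/subspace_continuousP: cF => /(_ _ cx).
move=> cFx; apply: cvg_comp cFx => A; rewrite /= /within /= => hA.
have cc : {for x, continuous (clip i)}.
  apply: continuous_max; first exact: cvg_cst.
  by apply: continuous_min => //; exact: cvg_cst.
have := cc _ hA; apply: (@filterS _ (nbhs x)) => z /=; apply; apply/pdomE.
exact: clip_dom.
Qed.

Lemma branch_ivt i x y v : x <= y -> branch i x <= v -> v <= branch i y ->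
  exists2 z, x <= z <= y & branch i z = v.
Proof.
move=> xy xv vy.
have [|z] := @IVT _ (branch i) x y v xy
  (continuous_subspaceT (@branch_continuous i)).
  by rewrite ge_min xv le_max vy orbT.
by rewrite in_itv /= => xzy <-; exists z.
Qed.

Local Notation word_branch := (foldl (fun z i => branch i z)).

Lemma word_branch_lt w x y : x < y -> pdom (word_comp F w) x ->
  pdom (word_comp F w) y -> word_branch x w < word_branch y w.
Proof.
elim: w x y => [//|i w IH] x y xy.
move=> /(word_comp_cons F i w).2[/pdomE xd xw].
move=> /(word_comp_cons F i w).2[/pdomE yd yw] /=.
rewrite !branch_dom //; apply: IH => //.
by apply: F_mono => //; [case/andP: xd|case/andP: yd].
Qed.

Lemma word_branch_mono w x y : x <= y -> word_branch x w <= word_branch y w.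
Proof. by elim: w x y => [//|i w IH] x y xy /=; exact/IH/branch_ndec. Qed.

(** Clipping creates no spurious laps: the interval where the tail of the word is defined is pulled
    back through the first branch by the intermediate value theorem. *)
Lemma word_branch_dom w x y : x <= y -> word_branch x w < word_branch y w ->
  exists c d, [/\ x <= c, c < d, d <= y &
    forall z, c <= z <= d -> pdom (word_comp F w) z].
Proof.
elim: w x y => [|i w IH] x y xy /= lt.
  by exists x, y; split.
have [c' [d' [xc cd dy dom]]] := IH _ _ (branch_ndec i xy) lt.
have clipK u : branch i (clip i u) = branch i u.
  by rewrite /branch (@clip_id _ (clip i u)) ?clip_dom.
have cxy : clip i x <= clip i y by exact: clip_mono.
have [c /andP[c1 c2] cE] : exists2 z, clip i x <= z <= clip i y & branch i z = c'.
  by apply: branch_ivt; rewrite ?clipK // (le_trans (ltW cd)).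
have [d /andP[d1 d2] dE] : exists2 z, clip i x <= z <= clip i y & branch i z = d'.
  by apply: branch_ivt; rewrite ?clipK // (le_trans xc) // ltW.
have /andP[lx _] := clip_dom i x; have /andP[_ yr] := clip_dom i y.
have lt_cd : c < d.
  by rewrite ltNge; apply/negP => /(branch_ndec i); rewrite cE dE leNgt cd.
have lt_clip : clip i x < clip i y by exact: le_lt_trans c1 (lt_le_trans lt_cd d2).
(* As the clipped points differ, [x] is not beyond the right end and [y] is not before the left end:
   clipping moves both inward. *)
have xr : x <= clip i x.
  move: lt_clip; rewrite /clip; case: (leP x (right_end i)) => [_ _|rx].
    by rewrite le_max lexx orbT.
  by rewrite min_r ?(le_trans (ltW rx) xy) // ltxx.
have yl : clip i y <= y.
  case: (clip_le i y) => // ly; move: lt_clip; rewrite ly ltNge.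
  by have /andP[-> _] := clip_dom i x.
exists c, d; split=> //; [exact: le_trans c1|exact: le_trans yl|].
move=> z /andP[cz zd]; apply/(word_comp_cons F i w).2.
have zdom : left_end i <= z <= right_end i.
  by rewrite (le_trans lx) ?(le_trans c1) //= (le_trans zd) // (le_trans d2).
split; first exact/pdomE.
rewrite -(branch_dom zdom); apply: dom.
by rewrite -cE -dE !branch_ndec.
Qed.

Lemma interior_word_dom w :
  (interior (pdom (word_comp F w)) !=set0) <->
  word_branch 0 w < word_branch 1 w.
Proof.
split=> [[x]|/(word_branch_dom ler01)[c [d [_ cd _ dom]]]]; last first.
  exists ((c + d) / 2).
  have : `]c, d[%classic `<=` interior (pdom (word_comp F w)).
    rewrite -open_subsetE; last exact: interval_open.
    move=> z /=; rewrite in_itv /= => /andP[cz zd]; apply: dom.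
    by rewrite !ltW.
  by apply; rewrite /= in_itv /= !midf_lt.
rewrite /interior /= => /nbhs_ballP[e /= e0 be].
have xd : pdom (word_comp F w) x by apply: be; exact: ballxx.
have yd : pdom (word_comp F w) (x + e / 2).
  apply: be; rewrite /ball /= opprD addNKr normrN ger0_norm ?divr_ge0 ?(ltW e0) //.
  by rewrite ltr_pdivrMr // mulr_natr mulr2n ltrDl.
have xy : x < x + e / 2 by rewrite ltrDl divr_gt0.
have := word_branch_lt xy xd yd.
(* The empty word is separate: its domain is the whole line, so the two points need not lie in
   [[0, 1]]. *)
case: w xd yd {be} => [|i w] xd yd; first by rewrite /= ltr01.
move=> lt; move/(word_comp_cons F i w).2: xd => [/pdomE/andP[lx _] _].
move/(word_comp_cons F i w).2: yd => [/pdomE/andP[_ yr] _].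
apply: le_lt_trans (word_branch_mono _ _) (lt_le_trans lt (word_branch_mono _ _)).
  exact: le_trans (left_end_ge0 i) lx.
exact: le_trans yr (right_end_le1 i).
Qed.

Lemma word_count_laps m : (word_count F m)%:R = laps branch m 0 1.
Proof.
rewrite -card_words_laps; congr (_%:R); apply: eq_card => w.
rewrite !inE; apply/asboolP/idP => /interior_word_dom; exact.
Qed.

Lemma word_count_le m : (word_count F m <= 2 ^ m)%N.
Proof. by rewrite (leq_trans (max_card _)) // card_tuple card_bool. Qed.

Lemma word_count_submul m n :
  (word_count F (m + n) <= word_count F m * word_count F n)%N.
Proof.
rewrite -(ler_nat R) natrM !word_count_laps.
exact: (laps_submul branch_ndec branch01).
Qed.

(** The rule for returns to [q] is the convention of [digit], so each digit is determined by the
    orbit point, and the total branches reproduce the orbit. *)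
Lemma critical_itineraryE c a : critical_itinerary F q c a ->
  a = itinerary q branch c q.
Proof.
case=> a0 ha; have {}ha k : piece q (a k) (word_comp F (mkseq a k) q) /\
    (word_comp F (mkseq a k) q = q -> a k = c).
  (* The definition constrains indices from 1 on; at index 0 the orbit point is [q], which lies in
     both pieces. *)
  case: k => [|k]; last exact: ha.
  rewrite a0; split=> //=; case/andP: q01 => q0 q1.
  by case: (c); rewrite /= in_itv /= lexx ?(ltW q0) ?(ltW q1).
have digitE k : a k = digit q c (word_comp F (mkseq a k) q).
  have [] := ha k; move: (word_comp F (mkseq a k) q) => x px xq.
  have [/[dup] /xq -> ->|x_q] := eqVneq x q.
    by rewrite /digit lexx ltxx; case: (c).
  have -> : digit q c x = (q < x).
    by rewrite /digit le_eqVlt eq_sym (negPf x_q); case: (c).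
  move: px; case: (a k); rewrite /= in_itv /= => /andP[h1 h2].
    by rewrite lt_neqAle eq_sym x_q h1.
  by rewrite ltNge h2.
apply/funext => k; rewrite digitE /itinerary; congr digit.
elim: k => [//|k IH]; rewrite iterS -IH mkseqS.
rewrite /word_comp foldl_rcons -/(word_comp F _) /=.
rewrite /step -digitE branch_dom //; apply/pdomE.
have [+ _] := ha k; case: (a k) => /=; by rewrite ?dom_true ?dom_false in_itv.
Qed.

(** * The growth rate as critical parameter *)

Section PositiveEntropy.
Local Notation s := (growth_rate F).
Hypothesis s_gt1 : 1 < s.

Lemma growth_rate_gt0 : 0 < s.
Proof. exact: lt_trans s_gt1. Qed.

Lemma growth_inv_gt0 : 0 < s^-1.
Proof. by rewrite invr_gt0 growth_rate_gt0. Qed.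

Lemma growth_inv01 : 0 <= s^-1 < 1.
Proof. by rewrite ltW ?growth_inv_gt0 //= invf_lt1 ?growth_rate_gt0. Qed.

Lemma laps_decay (t : R) : 0 < t -> t * s < 1 -> exists (rho : R) n,
  0 <= rho < 1 /\
  forall m, (n <= m)%N -> t ^+ m * laps branch m 0 1 <= rho ^+ m.
Proof.
(* The midpoint of [s] and [t^-1]: above [s] it bounds the word counts, below [t^-1] it makes
   [rho = t * r] less than 1. *)
move=> t0 ts1; pose r := (s + t^-1) / 2.
have sti : s < t^-1 by rewrite -[t^-1]mul1r ltr_pdivlMr // mulrC.
have [sr rt] : s < r /\ r < t^-1 by rewrite /r !midf_lt.
have [n hn] := growth_lt word_count_le sr.
exists (t * r), n; split.
  rewrite mulr_ge0 ?(ltW t0) ?(ltW (lt_trans growth_rate_gt0 sr)) //=.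
  by rewrite mulrC -ltr_pdivlMr // mul1r.
move=> m nm; rewrite exprMn -word_count_laps ler_wpM2l ?exprn_ge0 ?(ltW t0) //.
exact: hn.
Qed.

Lemma laps_growth m : s ^+ m <= laps branch m 0 1.
Proof.
case: m => [|m]; first by rewrite expr0 /laps /= ltr01.
rewrite -word_count_laps.
exact: (growth_submul word_count_le word_count_submul s_gt1).
Qed.

Lemma jump_growth_inv : jump q branch s^-1 = 0.
Proof.
exact (jump_critical q01 branch_ndec branch01 branch_false branch_true s_gt1
  laps_decay laps_growth).
Qed.

Section KneadingSeries.
Variables alpha beta : nat -> bool.
Hypothesis alpha_crit : critical_itinerary F q false alpha.
Hypothesis beta_crit : critical_itinerary F q true beta.

Lemma kneading_eq (t : R) : 0 <= t < 1 ->
  jump q branch t = 0 <-> digit_series alpha t = digit_series beta t.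
Proof.
move=> t01; rewrite (critical_itineraryE alpha_crit) (critical_itineraryE beta_crit).
exact: jump_eq0.
Qed.

(** Equality of the two series means a zero jump: the jump vanishes at [s^-1] and is positive at
    every smaller [t > 0]. *)
Lemma growth_inv_minimum : is_minimum
  [set t : R | 0 < t < 1 /\ digit_series alpha t = digit_series beta t] s^-1.
Proof.
split=> /=.
  split; last by apply/kneading_eq; [exact: growth_inv01|exact: jump_growth_inv].
  by rewrite growth_inv_gt0; case/andP: growth_inv01.
move=> t [/andP[t0 t1] /kneading_eq]; rewrite (ltW t0) t1 => /(_ isT) j0.
rewrite leNgt; apply/negP => ts.
have : 0 < jump q branch t.
  apply: (jump_gt0 q01 branch_ndec branch01 branch_false branch_true s_gt1
    laps_decay).
  by rewrite t0.
by rewrite j0 ltxx.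
Qed.

End KneadingSeries.

(** * The semiconjugacy and the affine system *)

Local Notation H := (itinerary_series q branch true s^-1).
Local Notation D := (H 1 - H 0).

Lemma critical_series_ndec (x y : R) : x <= y -> H x <= H y.
Proof.
apply: (series_ndec branch_ndec branch01 branch_false branch_true growth_inv01
  jump_growth_inv).
exact: (series_ndec_critical q01 branch_ndec branch01 branch_false branch_true
  s_gt1 laps_decay).
Qed.

Lemma critical_series_continuous : continuous H.
Proof.
move=> x; apply: (series_continuous branch_ndec branch01 branch_false branch_true
  growth_inv01 jump_growth_inv branch_continuous).
by move=> u v _ uv _; exact: critical_series_ndec.
Qed.

(** The branch equation solved for [H (F i x)]; at [q] it holds for both branches thanks to the zero
    jump. *)
Lemma critical_series_branch i x : left_end i <= x <= right_end i ->
  H (F i x) = s * (H x - i%:R).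
Proof.
move=> xi; rewrite -(branch_dom xi); move: xi; case: i => /= /andP[lx xr].
  rewrite (series_true branch growth_inv01 lx) [1 + _]addrC addrK.
  by rewrite mulrA divff ?gt_eqF ?growth_rate_gt0 // mul1r.
rewrite (series_false_le growth_inv01 jump_growth_inv xr) subr0.
by rewrite mulrA divff ?gt_eqF ?growth_rate_gt0 // mul1r.
Qed.

Lemma F_range i x : left_end i <= x <= right_end i -> 0 <= F i x <= 1.
Proof. by move=> xi; rewrite -branch_dom // branch01. Qed.

Lemma critical_series_between x : 0 <= x <= 1 -> H 0 <= H x <= H 1.
Proof. by case/andP=> x0 x1; rewrite !critical_series_ndec. Qed.

(** A constant value [h] of [H] on [[0, 1]] would satisfy both [h = s * h] and [h = s * (h - 1)] by
    the two equations at [q], contradicting [s > 0]. *)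
Lemma critical_series_variation_gt0 : 0 < D.
Proof.
have /andP[q0 q1] := q01.
rewrite subr_gt0 lt_neqAle critical_series_ndec ?ler01 // andbT; apply/eqP => H01E.
have Hcst x : 0 <= x <= 1 -> H x = H 0.
  by move=> /critical_series_between; rewrite -H01E => /le_anti.
have lq : left_end false <= q <= right_end false by rewrite /= ltW //= lexx.
have rq : left_end true <= q <= right_end true by rewrite /= lexx ltW.
have := critical_series_branch lq; have := critical_series_branch rq.
rewrite !(Hcst (F _ _)) ?F_range // (Hcst q) ?(ltW q0) ?(ltW q1) //=.
by move: (H 0) growth_rate_gt0 => h ? ? ?; lra.
Qed.

Definition semiconj x : R := (H x - H 0) / D.

Lemma semiconj0 : semiconj 0 = 0.
Proof. by rewrite /semiconj subrr mul0r. Qed.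

Lemma semiconj1 : semiconj 1 = 1.
Proof. by rewrite /semiconj divff ?gt_eqF ?critical_series_variation_gt0. Qed.

Lemma semiconj_ndec x y : x <= y -> semiconj x <= semiconj y.
Proof.
move=> xy; rewrite /semiconj ler_wpM2r ?invr_ge0 //.
  exact/ltW/critical_series_variation_gt0.
by rewrite lerB ?critical_series_ndec.
Qed.

Lemma semiconj01 x : 0 <= x <= 1 -> 0 <= semiconj x <= 1.
Proof.
by case/andP=> x0 x1; rewrite -{1}semiconj0 -semiconj1 !semiconj_ndec.
Qed.

Lemma semiconj_continuous : continuous semiconj.
Proof.
move=> x; apply: cvgMr_tmp; apply: cvgB; first exact: critical_series_continuous.
exact: cvg_cst.
Qed.

Lemma semiconj_ivt x y v : x <= y -> semiconj x <= v <= semiconj y ->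
  exists2 z, x <= z <= y & semiconj z = v.
Proof.
move=> xy /andP[xv vy].
have [|z] := @IVT _ semiconj x y v xy (continuous_subspaceT semiconj_continuous).
  by rewrite ge_min xv le_max vy orbT.
by rewrite in_itv /= => xzy <-; exists z.
Qed.

(** The constant term of [y -> s * (y - i)] after the change of variable [y -> (y - H 0) / D]. *)
Definition offset (i : bool) : R := ((s - 1) * H 0 - s * i%:R) / D.

Lemma semiconj_branch i x : left_end i <= x <= right_end i ->
  semiconj (F i x) = s * semiconj x + offset i.
Proof.
move=> xi; rewrite /semiconj /offset critical_series_branch // mulrA -mulrDl; congr (_ / _).
ring.
Qed.

(** The image of a piece, stretched by [s], still fits in [[0, 1]], so its length is at most
    [s^-1 < 1]. The two lengths add up to 1, so neither is zero. *)
Lemma semiconj_ends_lt i : semiconj (left_end i) < semiconj (right_end i).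
Proof.
have ii j : left_end j <= left_end j <= right_end j /\
            left_end j <= right_end j <= right_end j.
  by rewrite !lexx /= ltW ?ends_lt.
have gap j : semiconj (right_end j) - semiconj (left_end j) < 1.
  have [jl jr] := ii j.
  have el := semiconj_branch jl; have er := semiconj_branch jr.
  have /andP[_ r1] := semiconj01 (F_range jr); have /andP[l0 _] := semiconj01 (F_range jl).
  apply: (@le_lt_trans _ _ s^-1); last by case/andP: growth_inv01.
  rewrite -[s^-1]mulr1 ler_pdivlMl ?growth_rate_gt0 // mulrBr.
  by move: l0 r1; rewrite el er => l0 r1; lra.
have := gap (~~ i); have := semiconj0; have := semiconj1.
case: i => /=; lra.
Qed.

Definition affine_system i : partial_map R :=
  PartialMap `[semiconj (left_end i), semiconj (right_end i)]%classic
    (fun y => s * y + offset i).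

Lemma affine_system_is_system : is_system affine_system.
Proof.
move=> i; split.
- by exists (semiconj (left_end i)), (semiconj (right_end i)); split=> //;
    exact: semiconj_ends_lt.
- apply: continuous_subspaceT => x /=; apply: cvgD; last exact: cvg_cst.
  by apply: cvgMl_tmp; exact: cvg_id.
- by left=> x y _ _ xy /=; rewrite ltrD2r ltr_pM2l ?growth_rate_gt0.
Qed.

Lemma affine_system_semiconjugate :
  semiconjugate F `[0, 1]%classic affine_system `[0, 1]%classic.
Proof.
have ends01 i x : left_end i <= x <= right_end i -> 0 <= x <= 1.
  case/andP=> lx xr; rewrite (le_trans (left_end_ge0 i)) //=.
  exact: le_trans (right_end_le1 i).
(* Points of an affine domain lift to the original piece, so invariance of [[0, 1]] under the affine
   maps reduces to the range of [F]. *)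
have affine_dom i y : pdom (affine_system i) y ->
    exists2 x, left_end i <= x <= right_end i & semiconj x = y.
  by rewrite /= in_itv /= => /semiconj_ivt; apply; exact/ltW/ends_lt.
split.
- split=> i x /pdomE xi _ /=; rewrite in_itv /=; [exact: F_range|exact: ends01 xi].
- split=> i y /affine_dom[x xi <-] _.
    by rewrite /= in_itv /= -semiconj_branch // semiconj01 ?F_range.
  by rewrite /= in_itv /= semiconj01 // (ends01 i).
- exists id, semiconj; split.
  + by move=> x y _ _; exact: semiconj_ndec.
  + exact/continuous_subspaceT/semiconj_continuous.
  + apply/seteqP; split=> [_ [x + <-]|y] /=; rewrite !in_itv /=.
      exact: semiconj01.
    rewrite -{1}semiconj0 -{1}semiconj1 => /(semiconj_ivt ler01)[x x01 <-].
    by exists x => //=; rewrite in_itv.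
  + move=> i; split=> [_ [x [x01 /pdomE/andP[lx xr]] <-]|x [_ /pdomE xi]].
      move: x01; rewrite /= !in_itv /= => x01.
      by rewrite semiconj01 // !semiconj_ndec.
    exact: semiconj_branch.
Qed.

(** * Explicit normal form when the endpoints are fixed *)

Section FixedEndpoints.
Hypothesis F_false0 : F false 0 = 0.
Hypothesis F_true1 : F true 1 = 1.

(** The branch equation at the fixed point 0 reads [H 0 = s * H 0], with [s] different from 1. *)
Lemma critical_series_fixed0 : H 0 = 0.
Proof.
have : H (F false 0) = s * (H 0 - false%:R).
  by apply: critical_series_branch; rewrite /= lexx ltW //; case/andP: q01.
rewrite F_false0 subr0 => hs; have s1 : s - 1 != 0 by rewrite subr_eq0 gt_eqF.
by apply: (mulfI s1); rewrite mulr0 mulrBl mul1r -hs subrr.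
Qed.

(** At the fixed point 1 it reads [H 1 = s * (H 1 - 1)]. *)
Lemma critical_series_fixed1 : H 1 = (1 - s^-1)^-1.
Proof.
have := @critical_series_branch true 1; rewrite F_true1 /= lexx ltW; last by case/andP: q01.
have s0 : s != 0 by rewrite gt_eqF ?growth_rate_gt0.
have s1 : s - 1 != 0 by rewrite subr_eq0 gt_eqF.
move=> /(_ isT) eq; apply: (mulfI s1).
have -> : (s - 1) * H 1 = s by rewrite mulrBl mul1r {2}eq mulrBr mulr1 subKr.
by field; rewrite s0 s1.
Qed.

Lemma semiconj_fixed x : semiconj x = (1 - s^-1) * H x.
Proof.
by rewrite /semiconj critical_series_fixed0 !subr0 critical_series_fixed1 invrK mulrC.
Qed.

Lemma offset_fixed i : offset i = - ((s - 1) * i%:R).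
Proof.
rewrite /offset critical_series_fixed0 mulr0 subr0 critical_series_fixed1 invrK sub0r.
by have s0 : s != 0 by [rewrite gt_eqF ?growth_rate_gt0]; field.
Qed.

End FixedEndpoints.
End PositiveEntropy.
End LorenzSystem.

Theorem theorem6p5 (R : realType) (q : R) (F : bool -> partial_map R)
    (alpha beta : nat -> bool)
    (hq : 0 < q < 1)
    (hF : is_system F)
    (hdom0 : pdom (F false) = `[0, q]%classic)
    (hdom1 : pdom (F true) = `[q, 1]%classic)
    (hf0 : [/\ 0 <= F false 0, F false 0 < F false q & F false q <= 1])
    (hf1 : [/\ 0 <= F true q, F true q < F true 1 & F true 1 <= 1])
    (halpha : critical_itinerary F q false alpha)
    (hbeta : critical_itinerary F q true beta)
    (hs : (0 < topological_entropy F)%E) :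
  let s := growth_rate F in
  is_minimum
    [set t : R | 0 < t < 1 /\ digit_series alpha t = digit_series beta t]
    s^-1 /\
  exists U : bool -> partial_map R,
    [/\ is_system U,
        forall i : bool, affine_with_slope s (U i),
        semiconjugate F `[0, 1]%classic U `[0, 1]%classic &
        F false 0 = 0 -> F true 1 = 1 ->
        let p := (1 - s^-1) * digit_series alpha s^-1 in
        [/\ pdom (U false) = `[0, p]%classic,
            forall x, 0 <= x <= p -> U false x = s * x,
            pdom (U true) = `[p, 1]%classic &
            forall x, p <= x <= 1 -> U true x = s * (x - 1) + 1]].
Proof.
move=> s; have s_gt1 : 1 < s by move: hs; rewrite /topological_entropy lne_gt0 lte_fin.
split; first exact: (growth_inv_minimum hq hF hdom0 hdom1 hf0 hf1 s_gt1 halpha hbeta).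
exists (affine_system q F); split.
- exact: (affine_system_is_system hq hF hdom0 hdom1 hf0 hf1 s_gt1).
- by move=> i; exists (offset q F i).
- exact: (affine_system_semiconjugate hq hF hdom0 hdom1 hf0 hf1 s_gt1).
move=> F0 F1 p.
(* [semiconj] at [q] involves the series of [beta], whereas [p] is written with [alpha]; the two
   agree at [s^-1] by the first claim. *)
have pE : semiconj q F q = p.
  rewrite (semiconj_fixed hq hF hdom0 hdom1 hf0 hf1 s_gt1 F0 F1) /p.
  congr (_ * _); have [[_ ->] _] :=
    growth_inv_minimum hq hF hdom0 hdom1 hf0 hf1 s_gt1 halpha hbeta.
  by rewrite (critical_itineraryE hq hdom0 hdom1 hbeta).
have offE := offset_fixed hq hF hdom0 hdom1 hf0 hf1 s_gt1 F0 F1.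
split=> [|x _|  |x _] /=; rewrite ?pE ?semiconj0 ?offE //.
- by rewrite mulr0 oppr0 addr0.
- by rewrite (semiconj1 hq hF hdom0 hdom1 hf0 hf1 s_gt1).
- by rewrite /s mulr1 opprB mulrBr mulr1 addrAC -addrA.
Qed.
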